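(* Let $K$ be a field, let $m,n\ge 1$ be integers, and let $f(X,Y)=a_0+a_1Y+\cdots+a_mY^m$ and $g(X,Y)=b_0+b_1Y+\cdots+b_nY^n$, with $a_0,a_1,\ldots,a_m,b_0,b_1,\ldots,b_n\in K[X]$ and $a_0a_mb_n\neq 0$. Let $d_1\in K[X]$ be a factor of $a_m$ and $d_2\in K[X]$ a factor of $b_n$. If $$\deg a_m>mn\deg d_1+m^2n\deg d_2+H_1(f),$$ then the polynomial $f(X,g(X,Y))$ has at most $\Omega(a_m/d_1)+m\,\Omega(b_n/d_2)$ irreducible factors over $K(X)$. The same conclusion holds in the wider range $$\deg a_m>n\deg d_1+mn\deg d_2+H_1(f),$$ provided that $f$ is irreducible over $K(X)$.
   Context: For $f=a_0(X)+a_1(X)Y+\cdots+a_m(X)Y^m\in K[X,Y]$ with $a_m\ne 0$, $H_1(f)=\max\{\deg a_0,\ldots,\deg a_{m-1}\}$, where $\deg$ is the degree in $X$ (zero coefficients are ignored in the maximum, i.e. $\deg 0=-\infty$). For a nonzero polynomial $u\in K[X]$, $\Omega(u)$ denotes the number of irreducible factors of $u$ in $K[X]$, counting multiplicities, with $\Omega(c)=0$ for nonzero constants $c\in K$. ''Irreducible (factors) over $K(X)$'' refers to polynomials in $Y$ with coefficients in the field $K(X)$, i.e. to the ring $K(X)[Y]$. *)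

(* Defs.v *)
(* K[X,Y] is {poly {poly K}}, the outer variable being Y and
   the coefficients being polynomials in X. *)
From mathcomp Require Import all_boot all_order all_algebra.
From Stdlib Require Import Classical ClassicalEpsilon.

Set Implicit Arguments.
Unset Strict Implicit.
Unset Printing Implicit Defensive.

Import GRing.Theory.
Local Open Scope ring_scope.

(* The empty list factors every nonzero constant. *)
Definition irr_factorization (F : fieldType) (u : {poly F}) (s : seq {poly F}) :=
  (forall p, p \in s -> irreducible_poly p) /\ u %= \prod_(p <- s) p.

(* Number of irreducible factors, counted with multiplicity; it is used both
   for F = K and for F = K(X).  The choice operator is harmless for u != 0, by
   irr_factorization_ex and Omega_eq below; Omega 0 is an unspecified value. *)
Definition Omega (F : fieldType) (u : {poly F}) : nat :=
  epsilon (inhabits 0%N)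
    (fun k => exists2 s, irr_factorization u s & size s = k).

Definition degX (K : fieldType) (a : {poly K}) : nat := (size a).-1.

(* Zero coefficients are filtered out.  The maximum over an empty range is 0
   instead of -oo; this does not occur when f`_0 != 0 and f has positive
   degree in Y. *)
Definition H1 (K : fieldType) (f : {poly {poly K}}) : nat :=
  \max_(i < (size f).-1 | f`_i != 0) degX f`_i.

(* The image of a polynomial of K[X][Y] in K(X)[Y]. *)
Definition overKX (K : fieldType) (f : {poly {poly K}}) :
    {poly {fraction {poly K}}} :=
  map_poly (@tofrac {poly K}) f.

Section OmegaSpec.
Variable F : fieldType.
Implicit Types (u p q : {poly F}) (s t : seq {poly F}).

Lemma irr_factorization_ex u : u != 0 -> exists s, irr_factorization u s.
Proof.
have [n] := ubnP (size u); elim: n u => // n IHn u; rewrite ltnS => le_un u0.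
have [su|su] := leqP (size u) 1%N.
  exists [::]; split=> //; rewrite big_nil -size_poly_eq1.
  by rewrite eqn_leq su size_poly_gt0.
have [irr|nirr] := classic (irreducible_poly u).
  exists [:: u]; split; last by rewrite big_seq1 eqpxx.
  by move=> p; rewrite inE => /eqP->.
have [q [q1 [qu nqu]]] : exists q, size q != 1%N /\ q %| u /\ ~~ (q %= u).
  apply: NNPP => H; apply: nirr; split=> // q q1 qu.
  by case: (boolP (q %= u)) => // nqu; case: H; exists q.
have [r ur] := dvdpP _ _ qu.
have [r0 q0] : r != 0 /\ q != 0.
  by move: u0; rewrite ur mulf_eq0 negb_or => /andP[].
have sq : (size q < size u)%N.
  by rewrite ltn_neqAle dvdp_leq // andbT dvdp_size_eqp.
have sr : (size r < size u)%N.
  rewrite ur size_mul //; have := q1; have := q0; rewrite -size_poly_gt0.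
  case: (size q) => [//|[//|k]] _ _.
  by rewrite addnS /= addnS ltnS leq_addr.
have [s [irrs es]] := IHn r (leq_trans sr le_un) r0.
have [t [irrt et]] := IHn q (leq_trans sq le_un) q0.
exists (s ++ t); split.
  by move=> p; rewrite mem_cat => /orP[/irrs|/irrt].
rewrite big_cat /= ur; apply: (eqp_trans (eqp_mulr q es)).
exact: eqp_mull.
Qed.

Lemma irr_dvdp_prod p s : irreducible_poly p ->
  p %| \prod_(q <- s) q -> exists2 q, q \in s & p %| q.
Proof.
move=> irr; elim: s => [|q s IHs].
  rewrite big_nil dvdp1 => /eqP sp; by have := irr.1; rewrite sp.
rewrite big_cons => pd.
have [pq|npq] := boolP (p %| q); first by exists q; rewrite ?mem_head.
have cop : coprimep p q.
  have [g1|gp] := irredp_XsubCP irr (dvdp_gcdl p q).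
    by rewrite /coprimep size_poly_eq1.
  by case/negP: npq; rewrite -(eqp_dvdl _ gp) dvdp_gcdr.
move: pd; rewrite Gauss_dvdpr // => /IHs[r rs pr].
by exists r; rewrite ?inE ?rs ?orbT.
Qed.

Lemma irr_factorization_size u s t :
  irr_factorization u s -> irr_factorization u t -> size s = size t.
Proof.
move=> [irrs es] [irrt et].
have {u es et} : \prod_(p <- s) p %= \prod_(p <- t) p.
  by rewrite (eqp_trans _ et) // eqp_sym.
elim: s t irrs irrt => [|p s IHs] t irrs irrt.
  case: t irrt => // q t irrt; rewrite big_nil big_cons eqp_sym => e.
  have : q %| 1 by rewrite -(eqp_dvdr _ e) dvdp_mulIl.
  by rewrite dvdp1 => /eqP sq; have := (irrt q (mem_head _ _)).1; rewrite sq.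
rewrite big_cons => e.
have irrp := irrs p (mem_head _ _).
have [q qt pq] : exists2 q, q \in t & p %| q.
  by apply: irr_dvdp_prod => //; rewrite -(eqp_dvdr _ e) dvdp_mulIl.
have epq : p %= q.
  by apply: (irrt q qt).2 => //; rewrite neq_ltn irrp.1 orbT.
have pe := perm_to_rem qt.
rewrite (perm_size pe) /=; congr _.+1; apply: IHs.
- by move=> r rs; apply: irrs; rewrite inE rs orbT.
- by move=> r /mem_rem; apply: irrt.
move: e; rewrite (perm_big _ pe) /= big_cons => e.
rewrite -(eqp_mul2l _ _ (irredp_neq0 irrp)); apply: (eqp_trans e).
by rewrite eqp_mulr // eqp_sym.
Qed.

Lemma Omega_eq u s : irr_factorization u s -> Omega u = size s.
Proof.
move=> us; have ex : exists k, exists2 t, irr_factorization u t & size t = k.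
  by exists (size s), s.
have [t ut] := epsilon_spec (inhabits 0%N) _ ex; rewrite -/(Omega u) => <-.
exact: irr_factorization_size ut us.
Qed.

End OmegaSpec.

(* Main.v *)
Require Import Defs.
From mathcomp Require Import all_boot all_order all_algebra.
From mathcomp Require Import perm generic_quotient fraction zify ring.
Set Implicit Arguments.
Unset Strict Implicit.
Unset Printing Implicit Defensive.
Import GRing.Theory.
Local Open Scope ring_scope.

(** Write [a], [b] for the leading coefficients of [f] and [g] in [Y].  By
    Gauss's lemma a factorization of [f(g)] over [K(X)] into irreducible
    factors is, up to a constant in [Y], a product [F_1 ... F_k] in [K[X][Y]],
    and the leading coefficients of the [F_i] multiply to a divisor of
    [a b^m = (a/d1) (b/d2)^m * (d1 d2^m)].  If [k] exceeds the number of prime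
    factors of [(a/d1) (b/d2)^m], some [F = F_i] receives none of these primes
    ([pigeonhole_dvd]): its leading coefficient [t] divides [d1 d2^m], so that
    [deg t <= deg d1 + m deg d2].

    Such a factor cannot exist.  Since [F] is irreducible, it divides [f1(g)]
    for an irreducible factor [f1] of [f]; let [c] be the leading coefficient
    of [f1] and [e] its constant coefficient, which is not 0.

    - The polynomial [Phi(T) = Res_Y(g(Y) - T, F(Y))] vanishes at the values
      that [g] takes at the roots of [F], and its leading coefficient in [T] is
      [t^n] up to sign ([elimination]).  These values are roots of [f1], so
      [f1] divides [Phi] over [K(X)], and by Gauss's lemma a multiple of [f1]
      by an element of [K(X)] divides [Phi] in [K[X][T]].  Comparison of
      leading coefficients gives [deg c - deg e <= n deg t]
      ([lead_coef_factor_bound]); the difference on the left is the quantity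
      that rescaling [f1] does not change.

    - Extend the degree in [X] to an algebraic closure of [K(X)].  As
      [deg a > H1(f)], every root of [f] has degree at most
      [- (deg a - H1 f) / m].  The roots of [f1] are among them and have product
      [e / c] up to sign, so [deg a - H1 f <= m (deg c - deg e)].  The proof of
      [newton_slope] replaces the roots by a weighted degree on [K[X,Y]].

    Together, [deg a - H1 f <= m n (deg d1 + m deg d2)], against the
    hypothesis.  If [f] is irreducible, then [f1 = f], and the second point
    improves to [deg a - H1 f <= deg c - deg e]; this saves the factor [m]. *)

(** * Elimination of one variable by a resultant *)

Lemma coefM_top (R : nzRingType) (p q : {poly R}) (k l : nat) :
  (size p <= k.+1)%N -> (size q <= l.+1)%N -> (p * q)`_(k + l) = p`_k * q`_l.
Proof.
move=> sp sq; have lt_k : (k < (k + l).+1)%N by rewrite ltnS leq_addr.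
rewrite coefM (bigD1 (Ordinal lt_k)) //= addKn big1 ?addr0 // => j /eqP ne_jk.
have [lt_kj|le_jk] := ltnP k j.
  by rewrite nth_default ?mul0r //; apply: leq_trans sp _.
rewrite [q`__]nth_default ?mulr0 //; apply: leq_trans sq _.
suff: nat_of_ord j <> k by lia.
by move=> e; apply: ne_jk; apply: val_inj.
Qed.

Lemma coef_prod_top (R : comNzRingType) (I : finType)
    (p : I -> {poly R}) (e : I -> nat) :
  (forall i, size (p i) <= (e i).+1)%N ->
  (size (\prod_i p i)%R <= (\sum_i e i).+1)%N /\
  (\prod_i p i)`_(\sum_i e i) = \prod_i (p i)`_(e i).
Proof.
move=> sp; pose T (P : {poly R}) k c := (size P <= k.+1)%N /\ P`_k = c.
apply: (big_ind3 T) => [|p1 k x1 p2 l x2 [s1 <-] [s2 <-]|i _].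
- by split; rewrite ?size_poly1 ?coef1.
- split; last exact: coefM_top.
  by have := size_polyMleq p1 p2; lia.
- by split.
Qed.

(** The leading coefficient in [T] of a determinant whose row [i] has degree at
    most [e i] in [T] is read off row by row. *)
Lemma det_top (R : comNzRingType) d (M : 'M[{poly R}]_d) (e : 'I_d -> nat) :
  (forall i j, size (M i j) <= (e i).+1)%N ->
  (size (\det M)%R <= (\sum_i e i).+1)%N /\
  (\det M)`_(\sum_i e i) = \det (\matrix_(i, j) (M i j)`_(e i)).
Proof.
move=> sM.
have top s := coef_prod_top (fun i => sM i (s i)).
split.
  apply: leq_trans (size_sum _ _ _) _; apply/bigmax_leqP => s _.
  by rewrite -signr_odd mulr_sign; case: ifP => _; rewrite ?size_polyN;
    case: (top s).
rewrite coef_sum; apply: eq_bigr => s _.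
transitivity ((-1) ^+ perm.odd_perm s * \prod_i (M i (s i))`_(e i)).
  rewrite -(proj2 (top s)).
  by rewrite !mulr_sign; case: ifP; rewrite ?coefN.
by congr (_ * _); apply: eq_bigr => i _; rewrite mxE.
Qed.

(** [Phi(T)] is the resultant of [g(Y) - T] and [F(Y)] with respect to [Y]: it
    lies in the ideal generated by these two polynomials, and the substitution
    of [g(Y)] for [T] kills the first of them.  In the Sylvester matrix [T]
    occurs, with coefficient -1, only on the diagonal of the [deg F] rows that
    belong to [g(Y) - T]; the matrix of the top coefficients is therefore block
    triangular, with diagonal blocks minus the identity and a triangular matrix
    that has the leading coefficient of [F] on its diagonal. *)
Lemma elimination (D : idomainType) (F g : {poly D}) :
  (1 < size F)%N -> (1 < size g)%N ->
  exists Phi u : {poly D}, [/\ Phi \Po g = u * F, Phi != 0 &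
    lead_coef Phi = (-1) ^+ (size F).-1 * lead_coef F ^+ (size g).-1].
Proof.
move=> sF sg.
pose p : {poly {poly D}} := g^:P - ('X)%:P.
pose q : {poly {poly D}} := F^:P.
have sq : size q = size F by rewrite size_map_polyC.
have sgP : size g^:P = size g by rewrite size_map_polyC.
have sp : size p = size g.
  by rewrite /p size_polyDl // size_polyN sgP size_polyC polyX_eq0.
have cp k : p`_k = (g`_k)%:P - 'X *+ (k == 0%N).
  by rewrite coefB coef_map coefC /=; case: eqP.
have cq k : q`_k = (F`_k)%:P by rewrite coef_map.
pose Phi := resultant p q.
have [[u v] /= _ eqPhi] : {uv : {poly {poly D}} * {poly {poly D}}
   | (size uv.1 < size q)%N /\ (size uv.2 < size p)%N &
     Phi%:P = uv.1 * p + uv.2 * q}.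
  by apply: resultant_in_ideal; rewrite ?sp ?sq.
(* The evaluation at T = g(Y); the inner variable of p and q is T. *)
pose ev (w : {poly {poly D}}) : {poly D} := (map_poly (comp_poly g) w).['X].
have evC w : ev w%:P = w \Po g by rewrite /ev map_polyC hornerC.
have evP w : ev w^:P = w.
  rewrite /ev -map_poly_comp -[RHS]comp_polyXr /comp_poly; congr _.[_].
  by apply: eq_map_poly => c /=; rewrite comp_polyC.
(* Row degrees in T of the Sylvester matrix. *)
pose e (i : 'I_((size q).-1 + (size p).-1)) : nat :=
  if split i is inl _ then 1%N else 0%N.
pose n := (size g).-1.
pose r := (size F).-1.
have sume : (\sum_i e i)%N = r.
  rewrite big_split_ord /= [X in (X + _)%N](eq_bigr (fun _ => 1%N)); last first.
    by move=> i _; rewrite /e (unsplitK (inl i)).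
  rewrite sum1_card card_ord big1 ?addn0 ?sq // => i _.
  by rewrite /e (unsplitK (inr i)).
have sM i j : (size (Sylvester_mx p q i j) <= (e i).+1)%N.
  rewrite Sylvester_mxE /e; case: (split i) => k; case: (k <= j)%N;
      rewrite ?mulr1n ?mulr0n ?size_poly0 //.
    rewrite cp; apply: leq_trans (size_polyD _ _) _; rewrite geq_max size_polyN.
    rewrite (leq_trans (size_polyC_leq1 _)) //.
    by case: eqP; rewrite ?size_polyX ?size_poly0.
  by rewrite cq size_polyC_leq1.
have [sPhi cPhi] := det_top sM.
rewrite -/(resultant p q) -/Phi sume in sPhi cPhi.
have {}cPhi : Phi`_r = (-1) ^+ r * lead_coef F ^+ n.
  rewrite cPhi.
  set L := \matrix_(i, j) _.
  have LE i j : L i j = (Sylvester_mx p q i j)`_(e i) by rewrite mxE.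
  clearbody L.
  have -> : L = block_mx (- 1%:M) 0 (dlsubmx L) (drsubmx L).
    rewrite -[LHS]submxK; congr block_mx; apply/matrixP=> i j.
      rewrite !mxE LE /e Sylvester_mxE (unsplitK (inl i)) /=.
      case: (ltngtP i j) => [lt_ij|lt_ji|/val_inj->].
      - rewrite mulr1n cp coefB coefC subn_eq0 leqNgt lt_ij coef0 subr0.
        by rewrite -val_eqE /= ltn_eqF // mulr0n oppr0.
      - by rewrite mulr0n coef0 -val_eqE /= gtn_eqF // mulr0n oppr0.
      - by rewrite subnn cp mulr1n coefB coefC coefX eqxx sub0r.
    rewrite !mxE LE /e Sylvester_mxE (unsplitK (inl i)) /=.
    have lt_ij : (i < (size q).-1 + j)%N.
      by rewrite (leq_trans (ltn_ord i)) ?leq_addr.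
    by rewrite (ltnW lt_ij) mulr1n cp coefB coefC subn_eq0 leqNgt lt_ij coef0
      subr0.
  rewrite det_lblock -scaleN1r detZ det1 mulr1; congr (_ * _); first by rewrite sq.
  rewrite det_trig.
    under eq_bigr => i _.
      rewrite !mxE LE /e Sylvester_mxE (unsplitK (inr i)) /= leq_addl.
      rewrite addnK mulr1n cq coefC /= sq -/(lead_coef F); over.
    by rewrite prodr_const card_ord sp.
  apply/is_trig_mxP => i j lt_ij.
  rewrite !mxE LE /e Sylvester_mxE (unsplitK (inr i)) /=.
  case: leqP => h; last by rewrite mulr0n coef0.
  rewrite mulr1n cq coefC /= nth_default //.
  rewrite -sq; move: lt_ij sF; rewrite -sq.
  by move: (nat_of_ord i) (nat_of_ord j) (size q) => k l N; lia.
have nz : Phi`_r != 0.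
  rewrite cPhi mulf_neq0 ?signr_eq0 ?expf_neq0 ?lead_coef_eq0 //.
  by rewrite -size_poly_gt0; lia.
have sPhi' : size Phi = r.+1.
  apply/eqP; rewrite eqn_leq sPhi ltnNge; apply: contra nz => h.
  by rewrite nth_default.
exists Phi, (ev v); split.
- rewrite -evC eqPhi /ev rmorphD !rmorphM !hornerE.
  rewrite -!/(ev _) /q evP /p /ev rmorphB hornerD hornerN -!/(ev _) evP evC.
  by rewrite comp_polyX subrr mulr0 add0r.
- by rewrite -size_poly_gt0 sPhi'.
- by rewrite lead_coefE sPhi' cPhi.
Qed.

(** * Gauss's lemma for K[X][Y] *)

Lemma degXM (K : fieldType) (a b : {poly K}) :
  a != 0 -> b != 0 -> degX (a * b) = (degX a + degX b)%N.
Proof.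
move=> a0 b0; rewrite /degX size_mul //.
move: a0 b0; rewrite -!size_poly_gt0.
by case: (size a) (size b) => [|k] [|l] //= _ _; rewrite addnS.
Qed.

Lemma degXX (K : fieldType) (a : {poly K}) k : degX (a ^+ k) = (k * degX a)%N.
Proof. by rewrite /degX size_exp mulnC. Qed.

Lemma degX_dvd (K : fieldType) (a b : {poly K}) :
  b != 0 -> a %| b -> (degX a <= degX b)%N.
Proof. by move=> b0 /(dvdp_leq b0); rewrite /degX -!subn1 => /leq_sub2r. Qed.

Lemma fraction_quot (R : idomainType) (x : {fraction R}) :
  exists a, exists2 b, b != 0 & tofrac b * x = tofrac a.
Proof.
elim/quotW: x => x; exists \n_x, \d_x; first exact: denom_ratioP.
rewrite -[LHS]/(FracField.mul _ _) !piE /FracField.mulf.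
apply/eqmodP; rewrite /= FracField.equivfE.
by rewrite !numden_Ratio ?mul1r ?mulr1 ?oner_neq0 ?denom_ratioP //= mulrC.
Qed.

Lemma irredp_dvdM (F : fieldType) (p a b : {poly F}) :
  irreducible_poly p -> p %| a * b -> (p %| a) || (p %| b).
Proof.
move=> irr; have [//|np] := boolP (p %| a).
by rewrite Gauss_dvdpr // irreducible_poly_coprime.
Qed.

Section Gauss.
Variable K : fieldType.
Implicit Types (p c : {poly K}) (A B h : {poly {poly K}}).

Lemma dvd_coef_scale p A :
  (forall i, p %| A`_i) -> exists A', A = p *: A'.
Proof.
move=> dA; exists (\poly_(i < size A) (A`_i %/ p)); apply/polyP=> i.
rewrite coefZ coef_poly; case: ltnP => [_|le_Ai]; first by rewrite mulrC divpK.
by rewrite nth_default // mulr0.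
Qed.

(** Reduce the coefficients of [A] and [B] modulo [p].  If both reductions are
    nonzero, the product of their leading coefficients is a coefficient of a
    polynomial congruent to [A * B], and it is prime to [p]. *)
Lemma gauss_prime p A B : irreducible_poly p ->
  (forall i, p %| (A * B)`_i) ->
  (forall i, p %| A`_i) \/ (forall i, p %| B`_i).
Proof.
move=> irr dAB.
have red C : exists C1 C2 : {poly {poly K}}, C = C1 + p *: C2 /\
    (C1 != 0 -> ~~ (p %| lead_coef C1)).
  exists (\poly_(i < size C) (C`_i %% p)), (\poly_(i < size C) (C`_i %/ p)).
  split.
    apply/polyP=> i; rewrite coefD coefZ !coef_poly.
    case: ltnP => [_|le_Ci]; first by rewrite addrC mulrC -divp_eq.
    by rewrite nth_default // mulr0 addr0.
  set C1 := \poly_(_ < _) _ => C1nz.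
  have sC1 : (size (lead_coef C1) < size p)%N.
    rewrite lead_coefE coef_poly; case: ifP => _.
      by rewrite ltn_modp irredp_neq0.
    by rewrite size_poly0 size_poly_gt0 irredp_neq0.
  by apply: contraL sC1 => /dvdp_leq; rewrite -leqNgt; apply;
    rewrite lead_coef_eq0.
have [A1 [A2 [eA nA]]] := red A; have [B1 [B2 [eB nB]]] := red B.
have [A10|A1nz] := eqVneq A1 0.
  by left=> i; rewrite eA A10 add0r coefZ dvdp_mulIl.
have [B10|B1nz] := eqVneq B1 0.
  by right=> i; rewrite eB B10 add0r coefZ dvdp_mulIl.
have dA1B1 i : p %| (A1 * B1)`_i.
  have -> : A1 * B1 = A * B - p *: (A1 * B2 + A2 * B).
    rewrite eA eB -!mul_polyC; ring.
  by rewrite coefB coefZ dvdp_sub ?dvdp_mulIl.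
have := dA1B1 (size (A1 * B1)).-1; rewrite -lead_coefE lead_coefM.
by move=> /(irredp_dvdM irr); rewrite (negPf (nA A1nz)) (negPf (nB B1nz)).
Qed.

Lemma overKX_eq0 h : (overKX h == 0) = (h == 0).
Proof.
have [->|h0] := eqVneq h 0; first by rewrite /overKX rmorph0 eqxx.
by apply/negbTE; rewrite /overKX map_poly_eq0_id0 // tofrac_eq0 lead_coef_eq0.
Qed.

Lemma overKX_inj : injective (@overKX K).
Proof.
by apply: map_inj_poly; rewrite ?tofrac0 // => a b /eqP; rewrite tofrac_eq => /eqP.
Qed.

Lemma size_overKX h : size (overKX h) = size h.
Proof.
have [->|h0] := eqVneq h 0; first by rewrite /overKX rmorph0 !size_poly0.
by rewrite size_map_poly_id0 // tofrac_eq0 lead_coef_eq0.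
Qed.

Lemma overKXM A B : overKX (A * B) = overKX A * overKX B.
Proof. exact: rmorphM. Qed.

Lemma overKXZ c A : overKX (c *: A) = (tofrac c) *: overKX A.
Proof. exact: map_polyZ. Qed.

Lemma eqp_overKX_scale c A : c != 0 -> overKX (c *: A) %= overKX A.
Proof. by move=> c0; rewrite overKXZ eqp_scale // tofrac_eq0. Qed.

(** A prime factor of [c] divides all coefficients of [A] or all those of [B],
    and can be cancelled there; the relation [%=] over [K(X)] records that [A]
    and [B] change by a scalar only. *)
Lemma split_content c h A B : c != 0 -> c *: h = A * B ->
  exists A' B', [/\ h = A' * B', overKX A' %= overKX A & overKX B' %= overKX B].
Proof.
have [N] := ubnP (size c); elim: N => // N IHN in c A B *.
rewrite ltnS => sc c0 eAB.
have [s [irrs es]] := irr_factorization_ex c0.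
case: s irrs es => [_|p s irrs].
  rewrite big_nil -size_poly_eq1 => /size_poly1P[k k0 ck].
  exists (k^-1%:P *: A), B; split; rewrite ?eqpxx //.
    by rewrite -scalerAl -eAB ck scalerA -polyCM mulVf // scale1r.
  by rewrite eqp_overKX_scale // polyC_eq0 invr_eq0.
rewrite big_cons => es; have irr := irrs p (mem_head _ _).
have p0 := irredp_neq0 irr.
have /dvdpP[c' ec] : p %| c by rewrite (eqp_dvdr _ es) dvdp_mulIl.
have [c'0 _] : c' != 0 /\ p != 0.
  by move: c0; rewrite ec mulf_eq0 negb_or => /andP[].
have sc' : (size c' < N)%N.
  apply: leq_trans sc; rewrite ec size_mul //.
  by move: irr.1 (size c') => sp l; lia.
have dAB i : p %| (A * B)`_i by rewrite -eAB coefZ ec -mulrA dvdp_mull ?dvdp_mulIl.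
have cancel X : p *: (c' *: h) = p *: X -> c' *: h = X.
  move=> e; apply/eqP; rewrite -subr_eq0.
  have : p *: (c' *: h - X) == 0 by rewrite scalerBr e subrr.
  by rewrite -mul_polyC mulf_eq0 polyC_eq0 (negPf p0).
have ec' : p *: (c' *: h) = A * B by rewrite scalerA mulrC -ec.
case: (gauss_prime irr dAB) => /dvd_coef_scale[C eC].
  have /cancel/(IHN _ _ _ sc' c'0)[A' [B' [eh eA eB]]] :
      p *: (c' *: h) = p *: (C * B).
    by rewrite ec' eC scalerAl.
  exists A', B'; split=> //.
  by rewrite (eqp_trans eA) // eC eqp_sym eqp_overKX_scale.
have /cancel/(IHN _ _ _ sc' c'0)[A' [B' [eh eA eB]]] :
    p *: (c' *: h) = p *: (A * C).
  by rewrite ec' eC scalerAr.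
exists A', B'; split=> //.
by rewrite (eqp_trans eB) // eC eqp_sym eqp_overKX_scale.
Qed.

Lemma common_denominator (P : {poly {fraction {poly K}}}) :
  exists2 c, c != 0 & exists A, tofrac c *: P = overKX A.
Proof.
elim/poly_ind: P => [|P x [c c0 [A eA]]].
  by exists 1; rewrite ?oner_eq0 //; exists 0; rewrite scaler0 /overKX rmorph0.
have [a [b b0 ex]] := fraction_quot x.
exists (c * b); first by rewrite mulf_neq0.
exists (b *: A * 'X + (c * a)%:P).
have -> : overKX (b *: A * 'X + (c * a)%:P) =
    tofrac b *: (tofrac c *: P) * 'X + (tofrac c * (tofrac b * x))%:P.
  by rewrite eA ex -overKXZ -tofracM /overKX rmorphD rmorphM /= map_polyX map_polyC.
by rewrite scalerDr tofracM scalerA scalerAl [tofrac b * _]mulrC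
  -[_ *: x%:P]mul_polyC -polyCM mulrA.
Qed.

(** Gauss's lemma in the form used below: a factorization over [K(X)] comes
    from one in [K[X][Y]], up to scalars of [K(X)]. *)
Lemma split_over (h : {poly {poly K}}) (P Q : {poly {fraction {poly K}}}) :
  h != 0 -> overKX h %= P * Q ->
  exists A B, [/\ h = A * B, overKX A %= P & overKX B %= Q].
Proof.
move=> h0 /eqpP[[x y] /= /andP[x0 y0] e].
have [c c0 [A eA]] := common_denominator (y *: P).
have [d d0 [B eB]] := common_denominator Q.
have [b [a a0 eb]] := fraction_quot x.
have a0' : tofrac a != 0 by rewrite tofrac_eq0.
have b0 : b != 0 by have := mulf_neq0 a0' x0; rewrite eb tofrac_eq0.
have ehAB : (b * (c * d)) *: h = (a *: A) * B.
  apply: overKX_inj; rewrite overKXM !overKXZ -eA -eB !tofracM -eb.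
  rewrite -!scalerAl -!scalerAr !scalerA mulrAC.
  rewrite -(scalerA _ x) e scalerA; congr (_ *: _).
  by rewrite -!mulrA [y * _]mulrC.
have [|A' [B' [eh eA' eB']]] := split_content _ ehAB; first by rewrite !mulf_neq0.
exists A', B'; split=> //.
  rewrite (eqp_trans eA') // (eqp_trans (eqp_overKX_scale _ a0)) // -eA.
  have c0' : tofrac c != 0 by rewrite tofrac_eq0.
  exact: eqp_trans (eqp_scale _ c0') (eqp_scale _ y0).
by rewrite (eqp_trans eB') // -eB eqp_scale ?tofrac_eq0.
Qed.

(** The factor [c] of degree 0 in [Y] absorbs the scalar; it also covers the
    case of an empty [s], in which [h] itself is constant in [Y]. *)
Lemma lift_factorization h (s : seq {poly {fraction {poly K}}}) :
  h != 0 -> irr_factorization (overKX h) s ->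
  exists (c : {poly {poly K}}) (ts : seq {poly {poly K}}),
    [/\ h = c * \prod_(t <- ts) t, size c = 1%N, size ts = size s &
    forall t, t \in ts -> irreducible_poly (overKX t)].
Proof.
elim: s h => [|P s IHs] h h0 [irrs es].
  exists h, [::]; rewrite !big_nil mulr1 in es *; split=> //.
  by rewrite -size_overKX (eqp_size es) size_poly1.
rewrite big_cons in es.
have [A [B [eh eA eB]]] := split_over h0 es.
have B0 : B != 0 by apply: contraNneq h0 => B0; rewrite eh B0 mulr0.
have [|c [ts [eB' sc st irrt]]] := IHs B B0.
  by split=> // p ps; apply: irrs; rewrite inE ps orbT.
exists c, (A :: ts); split=> /=.
- by rewrite big_cons eh {1}eB' mulrCA.
- exact: sc.
- by rewrite st.
move=> t; rewrite inE => /orP[/eqP->|/irrt//].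
have [irrP1 irrP2] := irrs P (mem_head _ _).
split=> [|q q1 qA]; first by rewrite (eqp_size eA).
apply: eqp_trans (irrP2 q q1 _) _; first by rewrite -(eqp_dvdr _ eA).
by rewrite eqp_sym.
Qed.
End Gauss.

Section Bounds.
Variable K : fieldType.
Implicit Types f g h F : {poly {poly K}}.

(** * Degree bounds on an irreducible factor of f *)

(** With [Phi] from [elimination]: were [f] and [Phi] coprime over [K(X)],
    then [f(g)] and [Phi(g)] would be coprime too, but [F] divides both.  So the
    irreducible [f] divides [Phi], and a scalar multiple [A] of [f] divides it
    in [K[X][T]]; hence the leading coefficient of [A] divides that of [Phi].
    The constant coefficient of [f] enters because [A] may be obtained from [f]
    by removing a common factor of the coefficients. *)
Lemma lead_coef_factor_bound f g F :
  irreducible_poly (overKX f) -> f`_0 != 0 -> (1 < size g)%N -> (1 < size F)%N ->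
  overKX F %| overKX (f \Po g) ->
  (degX (lead_coef f) <= degX f`_0 + (size g).-1 * degX (lead_coef F))%N.
Proof.
move=> irr f00 sg sF dF.
have f0 : f != 0 by apply: contraNneq f00 => ->; rewrite coef0.
have F0 : F != 0 by rewrite -size_poly_gt0 ltnW.
have [Phi [u [ePhi Phi0 lPhi]]] := elimination sF sg.
have : overKX f %| overKX Phi.
  rewrite -[_ %| _]negbK -irreducible_poly_coprime //; apply/negP => cop.
  have := coprimep_comp_poly (overKX g) cop.
  rewrite /overKX -!map_comp_poly -!/(overKX _) => /coprimepP/(_ _ dF).
  rewrite ePhi overKXM dvdp_mull // => /(_ isT).
  by rewrite -size_poly_eq1 size_overKX gtn_eqF.
case/dvdpP=> w ew.
have eqw : overKX Phi %= overKX f * w by rewrite ew mulrC eqpxx.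
have [A [B [eAB eA _]]] := split_over Phi0 eqw.
have sAf : size A = size f by rewrite -size_overKX (eqp_size eA) size_overKX.
have [[x y] /= /andP[x0 y0] exy] := eqpP _ _ eA.
have ecoef i : x * tofrac A`_i = y * tofrac f`_i.
  by have := congr1 (fun p : {poly _} => p`_i) exy; rewrite !coefZ !coef_map.
have A0 : A != 0 by rewrite -size_poly_gt0 sAf size_poly_gt0.
have cross : lead_coef A * f`_0 = lead_coef f * A`_0.
  apply/eqP; rewrite -tofrac_eq !tofracM -(inj_eq (mulfI x0)) mulrA.
  by rewrite !lead_coefE sAf ecoef mulrCA ecoef mulrA [y * _]mulrC.
have A00 : A`_0 != 0.
  apply: contraNneq f00 => A00; move: cross; rewrite A00 mulr0 => /eqP.
  by rewrite mulf_eq0 lead_coef_eq0 (negPf A0).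
have lA : (degX (lead_coef A) <= (size g).-1 * degX (lead_coef F))%N.
  rewrite -degXX; apply: degX_dvd; first by rewrite expf_neq0 ?lead_coef_eq0.
  have := congr1 lead_coef eAB; rewrite lPhi lead_coefM.
  move=> /(congr1 ( *%R ((-1) ^+ (size F).-1))).
  by rewrite mulrA -expr2 sqrr_sign mul1r => ->; rewrite mulrCA dvdp_mulIl.
have := congr1 (@degX K) cross; rewrite !degXM ?lead_coef_eq0 // => e.
by apply: leq_trans (leq_addr (degX A`_0) _) _; rewrite -e addnC leq_add2l.
Qed.

(** [w] is the degree for which [X] has weight [m] and [Y] has weight [- lam],
    shifted by [lam * deg f] to stay in [nat].  The index [k] is the last one
    of maximal weight, so that it can be used to exclude cancellation in a
    product. *)
Lemma extremal_coef f (m lam : nat) : f != 0 ->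
  let w j := (m * degX f`_j + lam * ((size f).-1 - j))%N in
  exists2 k, f`_k != 0 & forall j, f`_j != 0 ->
    (w j <= w k)%N /\ ((k < j)%N -> (w j < w k)%N).
Proof.
move=> f0 w.
have lt_l : ((size f).-1 < size f)%N by rewrite prednK // size_poly_gt0.
have l0 : f`_(Ordinal lt_l) != 0 by rewrite /= -lead_coefE lead_coef_eq0.
pose P := fun i : 'I_(size f) => f`_i != 0.
(* As i < size f, maximizing M means maximizing w first and then the index. *)
pose M := fun i : 'I_(size f) => (w i * size f + i)%N.
have [k k0 max_k] := @arg_maxnP _ (Ordinal lt_l) P M l0.
exists k => // j j0.
have lt_j : (j < size f)%N.
  by rewrite ltnNge; apply: contra j0 => h; rewrite nth_default.
have := max_k (Ordinal lt_j) j0; rewrite /M /= => le_jk.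
have lt_k := ltn_ord k.
move: (w j) (w k) le_jk lt_k lt_j => a b; move: (nat_of_ord k) => k'.
by move: (size f) => N le_jk lt_k lt_j; split; nia.
Qed.

(** Of all terms [f1_i f2_l] with [i + l = k1 + k2], the one at the last
    indices [k1], [k2] of maximal weight has strictly the largest degree: in
    any other, [i > k1] or [l > k2], where the weight drops.  Here [a], [b],
    [c], [d] are the degrees of the coefficients of indices [i], [l], [k1],
    [k2]. *)
Lemma weight_cross (m lam N1 N2 k1 k2 i l a b c d : nat) :
  (k1 <= N1)%N -> (k2 <= N2)%N -> (i <= N1)%N -> (l <= N2)%N ->
  (i + l = k1 + k2)%N -> i <> k1 ->
  (m * a + lam * (N1 - i) <= m * c + lam * (N1 - k1))%N /\
    ((k1 < i)%N -> (m * a + lam * (N1 - i) < m * c + lam * (N1 - k1))%N) ->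
  (m * b + lam * (N2 - l) <= m * d + lam * (N2 - k2))%N /\
    ((k2 < l)%N -> (m * b + lam * (N2 - l) < m * d + lam * (N2 - k2))%N) ->
  (a + b < c + d)%N.
Proof.
move=> k1N k2N iN lN e ne [le1 s1] [le2 s2].
have eW : (lam * (N1 - i) + lam * (N2 - l) =
           lam * (N1 - k1) + lam * (N2 - k2))%N.
  by rewrite -!mulnDr; congr (_ * _)%N; lia.
have : (m * (a + b) < m * (c + d))%N; last by rewrite ltn_mul2l => /andP[].
rewrite !mulnDr; have [lt_ki|le_ik] := ltnP k1 i.
  by have := s1 lt_ki; lia.
by have /s2 : (k2 < l)%N; lia.
Qed.

(** The arithmetic that ends [newton_slope]: [a], [b] are the degrees of the
    extremal coefficients, [c], [d] those of the leading ones and [e] that of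
    the constant coefficient of the first factor. *)
Lemma weight_top (m lam N1 N2 k1 k2 a b c d e : nat) :
  m = (N1 + N2)%N -> (k1 <= N1)%N -> (k2 <= N2)%N -> (0 < N1)%N ->
  (k1 + k2 < m -> a + b + lam <= c + d)%N ->
  (k1 + k2 = m -> a + b = c + d)%N ->
  (m * d + lam * (N2 - N2) <= m * b + lam * (N2 - k2))%N ->
  (m * e + lam * (N1 - 0) <= m * a + lam * (N1 - k1))%N ->
  (m * e + lam <= m * c)%N.
Proof.
move=> em k1N k2N N10 hlt heq le2 le3.
have : (m * (a + b) + lam * (m - (k1 + k2)) <= m * (c + d))%N.
  have [lt|ge] := ltnP (k1 + k2) m; last first.
    by rewrite heq; [rewrite (eqP (_ : m - _ == 0)%N) ?muln0 ?addn0 //; lia | lia].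
  have := hlt lt; rewrite -(leq_pmul2l (_ : 0 < m)%N) ?mulnDr; last by lia.
  by apply: leq_trans; rewrite leq_add2l mulnC leq_mul //; lia.
have -> : (lam * (m - (k1 + k2)) = lam * (N1 - k1) + lam * (N2 - k2))%N.
  by rewrite -mulnDr; congr (_ * _)%N; lia.
have : (lam <= lam * N1)%N by rewrite leq_pmulr.
move: le2 le3; rewrite subnn muln0 addn0 subn0 !mulnDr; lia.
Qed.

(** Weights are additive: the coefficient of [f1 * f2] at the sum of the two
    extremal indices has the maximal weight of [f1] plus that of [f2].  By
    hypothesis the weight of [f1 * f2] is maximal at its leading coefficient,
    so the same holds for [f1]; comparison with the constant coefficient of
    [f1] gives the claim. *)
Lemma newton_slope f1 f2 (m lam : nat) :
  size (f1 * f2) = m.+1 -> (1 < size f1)%N -> f1`_0 != 0 ->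
  (forall j, (j < m)%N -> (f1 * f2)`_j != 0 ->
     (degX (f1 * f2)`_j + lam <= degX (f1 * f2)`_m)%N) ->
  (m * degX f1`_0 + lam <= m * degX (lead_coef f1))%N.
Proof.
move=> sf sf1 f100 hlam.
have [f10 f20] : f1 != 0 /\ f2 != 0.
  by apply/andP; rewrite -negb_or -mulf_eq0 -size_poly_gt0 sf.
have em : m = ((size f1).-1 + (size f2).-1)%N.
  move: sf; rewrite size_mul //; move: f10 f20; rewrite -!size_poly_gt0.
  by case: (size f1) (size f2) => [|a] [|b] //= _ _; rewrite addnS => -[].
have le_size h j : h`_j != 0 -> (j <= (size h).-1)%N.
  move=> hj; have : (j < size h)%N; last by case: (size h).
  by rewrite ltnNge; apply: contra hj => le; rewrite nth_default.
have [k1 nz1 max1] := extremal_coef m lam f10.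
have [k2 nz2 max2] := extremal_coef m lam f20.
have lt_k : (k1 < (k1 + k2).+1)%N by rewrite ltnS leq_addr.
have sk : size (f1 * f2)`_(k1 + k2) = size (f1`_k1 * f2`_k2).
  have nzP : (0 < size (f1`_k1 * f2`_k2)%R)%N by rewrite size_poly_gt0 mulf_neq0.
  rewrite coefM (bigD1 (Ordinal lt_k)) //= addKn size_polyDl //.
  apply: leq_ltn_trans (size_sum _ _ _) _.
  rewrite -(prednK nzP) ltnS; apply/bigmax_leqP => j /eqP ne_jk.
  have nej : nat_of_ord j <> k1 by move=> e; apply: ne_jk; apply: val_inj.
  have [j10|j1] := eqVneq f1`_j 0; first by rewrite j10 mul0r size_poly0.
  have [j20|j2] := eqVneq f2`_(k1 + k2 - j) 0.
    by rewrite j20 mulr0 size_poly0.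
  have : (degX (f1`_j * f2`_(k1 + k2 - j))%R < degX (f1`_k1 * f2`_k2)%R)%N.
    rewrite !degXM //.
    apply: weight_cross (max1 _ j1) (max2 _ j2) => //; try exact: le_size.
    by rewrite subnKC // -ltnS.
  by rewrite /degX; case: (size (f1`_j * _)).
have degk : degX (f1 * f2)`_(k1 + k2) = (degX f1`_k1 + degX f2`_k2)%N.
  by rewrite /degX sk -/(degX _) degXM.
have nzk : (f1 * f2)`_(k1 + k2) != 0.
  by rewrite -size_poly_gt0 sk size_poly_gt0 mulf_neq0.
have l2 : f2`_(size f2).-1 != 0 by rewrite -lead_coefE lead_coef_eq0.
have topdeg : degX (f1 * f2)`_m =
    (degX (lead_coef f1) + degX (lead_coef f2))%N.
  by rewrite -[m]/(m.+1.-1) -sf -lead_coefE lead_coefM degXM ?lead_coef_eq0.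
apply: weight_top em _ _ _ _ _ (proj1 (max2 _ l2)) (proj1 (max1 _ f100)).
- exact: le_size.
- exact: le_size.
- by case: (size f1) sf1 => [|[]].
- by move=> lt_km; rewrite -degk -topdeg hlam.
- by move=> ek; rewrite -degk -topdeg ek.
Qed.

(** Each prime of [s] is cancelled against at most one element of [ts]; an
    element that is left over divides [b]. *)
Lemma pigeonhole_dvd (s ts : seq {poly K}) (b : {poly K}) :
  (forall p, p \in s -> irreducible_poly p) -> (size s < size ts)%N ->
  \prod_(t <- ts) t %| \prod_(p <- s) p * b -> exists2 t, t \in ts & t %| b.
Proof.
elim: s ts => [|p s IHs] ts irrs; rewrite /= ?big_nil ?mul1r.
  case: ts => // t ts _; rewrite big_cons => h; exists t; first exact: mem_head.
  exact: dvdp_trans (dvdp_mulIl _ _) h.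
move=> lt_s; rewrite big_cons -mulrA => dvd.
have irr := irrs p (mem_head _ _).
have irrs' q : q \in s -> irreducible_poly q.
  by move=> qs; apply: irrs; rewrite inE qs orbT.
have [pts|npts] := boolP (p %| \prod_(t <- ts) t); last first.
  apply: IHs => //; first exact: ltnW.
  by move: dvd; rewrite Gauss_dvdpr // coprimep_sym irreducible_poly_coprime.
have [t tts pt] : exists2 t, t \in ts & p %| t.
  elim: {lt_s dvd} ts pts => [|t ts IHt]; rewrite ?big_nil ?big_cons.
    by rewrite dvdp1 => /eqP sp; have := irr.1; rewrite sp.
  case/(irredp_dvdM irr)/orP=> [pt|/IHt[t' t'ts pt']].
    by exists t; rewrite ?mem_head.
  by exists t'; rewrite // inE t'ts orbT.
have pe := perm_to_rem tts.
have [||t' t'ts dt'] := IHs (rem t ts) irrs'.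
- by move: lt_s; rewrite (perm_size pe).
- rewrite -(dvdp_mul2l _ _ (irredp_neq0 irr)); apply: dvdp_trans dvd.
  by rewrite (perm_big _ pe) /= big_cons dvdp_mul.
by exists t'; rewrite // (mem_rem t'ts).
Qed.

End Bounds.

(** * Factors of the composition *)

Lemma irr_factor_of_comp (K : fieldType) (f g F : {poly {poly K}}) :
  f != 0 -> irreducible_poly (overKX F) -> overKX F %| overKX (f \Po g) ->
  exists f1 f2, [/\ f = f1 * f2, irreducible_poly (overKX f1) &
    overKX F %| overKX (f1 \Po g)].
Proof.
move=> f0 irrF; have [|s fs] := @irr_factorization_ex _ (overKX f).
  by rewrite overKX_eq0.
have [c [ts [ef sc _ irrt]]] := lift_factorization f0 fs.
have [k k0 ck] : exists2 k, k != 0 & c = k%:P by apply/size_poly1P/eqP.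
rewrite ef comp_polyM ck comp_polyC overKXM => /(irredp_dvdM irrF)/orP[Fc|].
  have := dvdp_leq _ Fc; rewrite overKX_eq0 polyC_eq0 => /(_ k0).
  by rewrite [size (overKX _%:P)]size_overKX size_polyC k0 /= leqNgt irrF.1.
have -> : overKX ((\prod_(t <- ts) t) \Po g) =
    \prod_(P <- [seq overKX (t \Po g) | t <- ts]) P.
  rewrite big_map; elim: ts {ef irrt} => [|t ts IHts].
    by rewrite !big_nil comp_polyC /overKX rmorph1.
  by rewrite !big_cons comp_polyM overKXM IHts.
case/(irr_dvdp_prod irrF)=> P /mapP[t tts ->] Ft.
exists t, (c * \prod_(u <- rem t ts) u); split=> //; last exact: irrt.
by rewrite ck (perm_big _ (perm_to_rem tts)) /= big_cons mulrCA.
Qed.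

Lemma Omega_factorization (K : fieldType) (a b : {poly K}) (m : nat) :
  a != 0 -> b != 0 -> exists2 s, irr_factorization (a * b ^+ m) s &
    size s = (Omega a + m * Omega b)%N.
Proof.
move=> /irr_factorization_ex[s sa] /irr_factorization_ex[t tb].
rewrite (Omega_eq sa) (Omega_eq tb).
exists (s ++ flatten (nseq m t)); last first.
  rewrite size_cat; congr (_ + _)%N; elim: m => //= m IHm.
  by rewrite size_cat IHm mulSn.
split.
  move=> p; rewrite mem_cat => /orP[/sa.1//|/flattenP[u]].
  by rewrite mem_nseq => /andP[_ /eqP->] /tb.1.
rewrite big_cat /=; apply: eqp_trans (eqp_mulr _ sa.2) (eqp_mull _ _).
elim: m => [|m IHm]; first by rewrite big_nil expr0 eqpxx.
rewrite exprS big_cat /=; exact: eqp_trans (eqp_mulr _ tb.2) (eqp_mull _ IHm).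
Qed.

Lemma factor_with_small_lead_coef (K : fieldType) (h : {poly {poly K}})
    (s : seq {poly K}) (b : {poly K}) :
  h != 0 -> (forall p, p \in s -> irreducible_poly p) ->
  lead_coef h %| \prod_(p <- s) p * b -> (size s < Omega (overKX h))%N ->
  exists F, [/\ irreducible_poly (overKX F), overKX F %| overKX h &
    lead_coef F %| b].
Proof.
move=> h0 irrs dh; have [|fs hfs] := @irr_factorization_ex _ (overKX h).
  by rewrite overKX_eq0.
rewrite (Omega_eq hfs); have [c [ts [eh _ <- irrt]]] := lift_factorization h0 hfs.
rewrite -(size_map lead_coef ts) => lt_s.
have [|t' /mapP[F Fts ->] Fb] :=
    @pigeonhole_dvd _ s (map lead_coef ts) b irrs lt_s.
  apply: dvdp_trans dh.
  rewrite eh lead_coefM lead_coef_prod big_map; exact: dvdp_mulIr.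
exists F; split=> //; first exact: irrt.
by rewrite eh (perm_big _ (perm_to_rem Fts)) /= big_cons mulrCA overKXM dvdp_mulIl.
Qed.

Theorem theorem1 (K : fieldType) (m n : nat) (hm : (1 <= m)%N) (hn : (1 <= n)%N)
    (f g : {poly {poly K}}) (hf : size f = m.+1) (hg : size g = n.+1)
    (ha0 : f`_0 != 0)
    (d1 d2 : {poly K}) (hd1 : d1 %| f`_m) (hd2 : d2 %| g`_n) :
  ((m * n * degX d1 + m ^ 2 * n * degX d2 + H1 f < degX f`_m)%N ->
   (Omega (overKX (f \Po g)) <= Omega (f`_m %/ d1) + m * Omega (g`_n %/ d2))%N)
  /\
  (irreducible_poly (overKX f) ->
   (n * degX d1 + m * n * degX d2 + H1 f < degX f`_m)%N ->
   (Omega (overKX (f \Po g)) <= Omega (f`_m %/ d1) + m * Omega (g`_n %/ d2))%N).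
Proof.
have f0 : f != 0 by rewrite -size_poly_gt0 hf.
have g0 : g != 0 by rewrite -size_poly_gt0 hg.
have am0 : f`_m != 0 by rewrite -[m]/(m.+1.-1) -hf -lead_coefE lead_coef_eq0.
have bn0 : g`_n != 0 by rewrite -[n]/(n.+1.-1) -hg -lead_coefE lead_coef_eq0.
have [a0' d10] : f`_m %/ d1 != 0 /\ d1 != 0.
  by apply/andP; rewrite -negb_or -mulf_eq0 divpK.
have [b0' d20] : g`_n %/ d2 != 0 /\ d2 != 0.
  by apply/andP; rewrite -negb_or -mulf_eq0 divpK.
have sg : (1 < size g)%N by rewrite hg.
have lfg : lead_coef (f \Po g) = f`_m * g`_n ^+ m.
  by rewrite lead_coef_comp // !lead_coefE hf hg.
have fg0 : f \Po g != 0 by rewrite -lead_coef_eq0 lfg mulf_neq0 ?expf_neq0.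
have [s [irrs es] ss] := Omega_factorization m a0' b0'.
rewrite -ss.
have core : (size s < Omega (overKX (f \Po g)))%N ->
    exists F, [/\ irreducible_poly (overKX F), overKX F %| overKX (f \Po g) &
      (degX (lead_coef F) <= degX d1 + m * degX d2)%N].
  move=> lt_s.
  have [|F [irrF dF lF]] :=
    @factor_with_small_lead_coef _ (f \Po g) s (d1 * d2 ^+ m) fg0 irrs _ lt_s.
    rewrite -(eqp_dvdr _ (eqp_mulr _ es)) lfg mulrACA -exprMn !divpK //.
  exists F; split=> //.
  rewrite -degXX -degXM ?expf_neq0 //.
  by apply: degX_dvd lF; rewrite mulf_neq0 ?expf_neq0.
have leH1 j : (j < m)%N -> f`_j != 0 -> (degX f`_j <= H1 f)%N.
  move=> lt_jm j0; have lt_j : (j < (size f).-1)%N by rewrite hf.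
  exact: (@leq_bigmax_cond _ (fun i : 'I_(size f).-1 => f`_i != 0)
    (fun i => degX f`_i) (Ordinal lt_j)).
split=> [ineq|irrf ineq]; rewrite leqNgt; apply/negP => /core[F [irrF dF lF]].
  have sF : (1 < size F)%N by rewrite -size_overKX irrF.1.
  have [f1 [f2 [ef irr1 dF1]]] := irr_factor_of_comp f0 irrF dF.
  have f100 : f1`_0 != 0.
    by apply: contraNneq ha0 => e; rewrite ef coef0M e mul0r.
  have sf1 : (1 < size f1)%N by rewrite -size_overKX irr1.1.
  have B1 := lead_coef_factor_bound irr1 f100 sg sF dF1.
  pose lam := (degX f`_m - H1 f)%N.
  have B2 : (m * degX f1`_0 + lam <= m * degX (lead_coef f1))%N.
    apply: (@newton_slope _ f1 f2); rewrite -?ef // => j lt_jm j0.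
    apply: leq_trans (leq_add (leH1 j lt_jm j0) (leqnn lam)) _.
    by rewrite subnKC // ltnW // (leq_ltn_trans (leq_addl _ _) ineq).
  have B3 : (m * degX (lead_coef f1) <=
      m * degX f1`_0 + (m * n * degX d1 + m ^ 2 * n * degX d2))%N.
    have -> : (m * n * degX d1 + m ^ 2 * n * degX d2 =
               m * (n * (degX d1 + m * degX d2)))%N by ring.
    rewrite -mulnDr leq_mul2l (leq_trans B1) ?orbT // leq_add2l hg.
    by rewrite leq_mul2l lF orbT.
  by have := leq_trans B2 B3; rewrite leq_add2l leqNgt ltn_subRL addnC ineq.
have sF : (1 < size F)%N by rewrite -size_overKX irrF.1.
have B1 := lead_coef_factor_bound irrf ha0 sg sF dF.
move: ineq; rewrite ltnNge => /negP[].
rewrite -[X in (_ <= X)%N]addnC.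
have -> : (n * degX d1 + m * n * degX d2 = n * (degX d1 + m * degX d2))%N by ring.
have -> : f`_m = lead_coef f by rewrite lead_coefE hf.
apply: leq_trans B1 (leq_add (leH1 0%N hm ha0) _).
by rewrite hg leq_mul2l lF orbT.
Qed.
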